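(* Let $n\ge2$ be an integer and $0<\alpha<1$. Then for every measurable set $A\subset[0,1)$, $$\|S_1(\mathbbm 1_A)\|_\alpha\ge|A|^*.$$ Moreover, for each $\alpha\in(0,1)$, there exist a constant $C_{\alpha,n}<\infty$ and a sequence of sets $A_j\in\mathcal N$ such that $|A_j|\to0$ and $$\|S_1(\mathbbm 1_{A_j})\|_\alpha\le C_{\alpha,n}|A_j|.$$
   Context: $[0,1)$ carries Lebesgue measure, $|A|$ is the Lebesgue measure of $A$, and $|A|^*=\min\{|A|,1-|A|\}$. For $m\ge0$, let $\mathcal I_m=\{[k/n^m,(k+1)/n^m):k=0,\dots,n^m-1\}$, $\mathcal N_m=\sigma(\mathcal I_m)$, and $\mathcal N=\bigcup_{m\ge0}\mathcal N_m$. For $f\in L^1[0,1)$ put $f_m=\mathbb E(f\mid\mathcal N_m)$ for $m\ge0$, $d_m=f_m-f_{m-1}$ for $m\ge1$, and $S_1(f)=\sum_{m\ge1}|d_m|$ (value $+\infty$ allowed). For measurable $g\ge0$, $\|g\|_\alpha=\big(\int_0^1g^\alpha\,dx\big)^{1/\alpha}$ (possibly $+\infty$). *)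

(* Defs.v *)
From HB Require Import structures.
From mathcomp Require Import all_boot all_order all_algebra.
From mathcomp Require Import all_classical all_reals all_analysis.

Set Implicit Arguments.
Unset Strict Implicit.
Unset Printing Implicit Defensive.
Import Order.TTheory GRing.Theory Num.Theory.
Import numFieldNormedType.Exports.
Local Open Scope classical_set_scope.
Local Open Scope ring_scope.

Section ConditionalExpectation.
Context d (T : measurableType d) (R : realType).
Variable mu : {measure set T -> \bar R}.

(* [G] is a sigma-algebra of subsets of [D] (in the sense of [sigma_algebra D]),
   so conditional expectations are functions on [D]; their values outside [D]
   are irrelevant. *)
Definition is_cond_exp (D : set T) (G : set (set T)) (f g : T -> R) : Prop :=
  [/\ forall Y : set R, measurable Y -> G (D `&` g @^-1` Y),
      mu.-integrable D (EFin \o g) &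
      forall B, G B ->
        (\int[mu]_(x in B) (g x)%:E = \int[mu]_(x in B) (f x)%:E)%E].

(* A chosen version. For the algebras [nadic n m] below, two versions agree at
   every point of [0, 1), since every atom has positive measure. *)
Definition cond_exp (D : set T) (G : set (set T)) (f : T -> R) : T -> R :=
  xget (cst 0) [set g | is_cond_exp D G f g].

End ConditionalExpectation.

(* The real line with the Lebesgue (and not only the Borel) measurable sets,
   i.e., the domain of [completed_lebesgue_measure]. *)
Definition lebesgueType (R : realType) :=
  caratheodory_type ((wlength (R := R) idfun)^*)%mu.

Section NadicMartingale.
Context (R : realType).

Definition leb : {measure set (lebesgueType R) -> \bar R} :=
  @completed_lebesgue_measure R.

Definition I01 : set R := `[0, 1[.

Definition leb_star (A : set R) : \bar R :=
  Order.min (leb A) (1 - leb A)%E.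

Definition nadic_itv (n m : nat) : set (set R) :=
  [set `[k%:R / n%:R ^+ m, k.+1%:R / n%:R ^+ m[%classic
     | k in [set k | (k < n ^ m)%N]].

Definition nadic (n m : nat) : set (set R) := <<s I01, nadic_itv n m >>.

Definition nadic_all (n : nat) : set (set R) := \bigcup_m nadic n m.

Definition mart (n : nat) (f : R -> R) (m : nat) : R -> R :=
  cond_exp leb I01 (nadic n m) f.

Definition mart_diff (n : nat) (f : R -> R) (m : nat) (x : R) : R :=
  mart n f m x - mart n f m.-1 x.

Definition S1 (n : nat) (f : R -> R) (x : R) : \bar R :=
  (\sum_(1 <= m <oo) `|mart_diff n f m x|%:E)%E.

(* [Lnorm] integrates over the whole type; here the domain is [0, 1). *)
Definition norm01 (alpha : R) (g : R -> \bar R) : \bar R :=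
  ((\int[leb]_(x in I01) (g x `^ alpha)) `^ alpha^-1)%E.

End NadicMartingale.

(* Main.v *)
(* Lower bound: the martingale of 1_A starts at |A| and converges to 1_A almost
   everywhere (Lebesgue differentiation along the n-adic intervals, which shrink
   nicely), so S_1(1_A) >= |1_A - |A|| >= |A|^* almost everywhere. Every norm of
   order alpha on a probability space then gives the bound.
   Upper bound: for A_j = [0, n^-j), f_m = n^(m-j) on [0, n^-m) and 0 elsewhere
   if m <= j, and f_m = 1_{A_j} if m >= j; hence S_1 <= 2 sum_{m <= j} f_m. As
   t |-> t^alpha is subadditive, the integral of S_1^alpha is at most
   2^alpha n^(-j alpha) times a geometric series of ratio n^(alpha-1) < 1. *)
Require Import Defs.
From HB Require Import structures.
From mathcomp Require Import all_boot all_order all_algebra.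
From mathcomp Require Import all_classical all_reals all_analysis.
From mathcomp Require Import measurable_realfun lra.

Set Implicit Arguments.
Unset Strict Implicit.
Unset Printing Implicit Defensive.
Import Order.TTheory GRing.Theory Num.Theory.
Import numFieldNormedType.Exports.
Local Open Scope classical_set_scope.
Local Open Scope ring_scope.

(** * The n-adic cells and the sets measurable at one level *)

Section NadicCells.
Context (R : realType) (n : nat) (n_gt0 : (0 < n)%N).
Implicit Types (m k : nat) (x : R).

Definition cell m k : set R :=
  `[k%:R / n%:R ^+ m, k.+1%:R / n%:R ^+ m[%classic.

(** On negative numbers [Num.truncn] returns [0], which is why [cellP] also carries [0 <= x]. *)
Definition cell_index m x : nat := Num.truncn (x * n%:R ^+ m).

Lemma expn_gt0R m : 0 < n%:R ^+ m :> R.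
Proof. by rewrite exprn_gt0// ltr0n. Qed.

Lemma cellP m k x : cell m k x <-> 0 <= x /\ cell_index m x = k.
Proof.
rewrite /cell /cell_index /= in_itv/= ler_pdivrMr ?ltr_pdivlMr ?expn_gt0R//.
split=> [/[dup] /andP[kx _] xk|[x0 <-]].
  split; last exact: truncn_def.
  by rewrite -(pmulr_lge0 _ (expn_gt0R m)) (le_trans _ kx).
by rewrite truncn_itv// mulr_ge0// ltW// expn_gt0R.
Qed.

Lemma cell_cell_index m x : 0 <= x -> cell m (cell_index m x) x.
Proof. by move=> x0; apply/cellP. Qed.

Lemma cell_index_lt m x : @I01 R x -> (cell_index m x < n ^ m)%N.
Proof.
rewrite /I01/= in_itv/= => /andP[x0 x1].
rewrite truncn_lt_nat ?mulr_ge0 ?(ltW (expn_gt0R _))//.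
rewrite natrX.
by rewrite -[ltRHS]mul1r ltr_pM2r ?expn_gt0R.
Qed.

Lemma I01_ge0 x : @I01 R x -> 0 <= x.
Proof. by rewrite /I01/= in_itv/= => /andP[]. Qed.

Lemma cell_I01 m k : (k < n ^ m)%N -> cell m k `<=` @I01 R.
Proof.
move=> km x /= xmk; have [x0 _] := (cellP m k x).1 xmk.
move: xmk; rewrite /cell /I01 /= !in_itv/= x0 => /andP[_ xk].
by rewrite (lt_le_trans xk)// ler_pdivrMr ?expn_gt0R// mul1r -natrX ler_nat.
Qed.

Lemma measurable_leb_itv (i : interval R) :
  measurable ([set` i] : set (lebesgueType R)).
Proof. by apply: sub_caratheodory; exact: measurable_itv. Qed.

Lemma measurable_cell m k : measurable (cell m k : set (lebesgueType R)).
Proof. exact: measurable_leb_itv. Qed.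

Lemma measurable_I01 : measurable (@I01 R : set (lebesgueType R)).
Proof. exact: measurable_leb_itv. Qed.

Lemma leb_itvco (a b : R) : a <= b -> leb R `[a, b[%classic = (b - a)%:E.
Proof.
move=> ab; have := lebesgue_measure_itv `[a, b[; rewrite /= lte_fin => H.
apply: etrans H _; rewrite lt_neqAle ab andbT.
by case: eqP => //= ->; rewrite subrr.
Qed.

Lemma leb_I01 : leb R (@I01 R) = 1%E.
Proof. by rewrite leb_itvco// subr0. Qed.

Lemma leb_cell m k : leb R (cell m k) = ((n%:R ^+ m)^-1)%:E.
Proof.
rewrite leb_itvco.
  by rewrite -mulrBl -natrB// subSnn mul1r.
by rewrite ler_pM2r ?invr_gt0 ?expn_gt0R// ler_nat.
Qed.

Lemma nadic_cell m k : (k < n ^ m)%N -> nadic n m (cell m k).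
Proof. by move=> km; apply: sub_sigma_algebra; exists k. Qed.

(** For subsets of [I01], this is the pointwise form of being a union of level-[m] cells. *)
Definition saturated m (B : set R) :=
  forall x y, @I01 R x -> @I01 R y -> cell_index m x = cell_index m y ->
  B x -> B y.

(** Padding with [set0] lets the finite family of cells inside [B] be indexed by all naturals, so
    that results on countable disjoint unions apply to it. *)
Definition cell_in (B : set R) m k : set R :=
  if `[< (k < n ^ m)%N /\ cell m k `<=` B >] then cell m k else set0.

Lemma cell_inE (B : set R) m : B `<=` @I01 R -> saturated m B ->
  B = \bigcup_k cell_in B m k.
Proof.
move=> BI uB; apply/seteqP; split=> [x Bx|x [k _]]; last first.
  by rewrite /cell_in; case: asboolP => // -[_]; exact.
exists (cell_index m x) => //; rewrite /cell_in; case: asboolP.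
  by move=> _; apply: cell_cell_index; exact/I01_ge0/BI.
case; split; first exact/cell_index_lt/BI.
move=> y xy; have yI : @I01 R y.
  by apply: cell_I01 xy; exact/cell_index_lt/BI.
by apply: (uB x) => //; [exact: BI|have /cellP[_ ->] := xy].
Qed.

(** The saturated subsets of [I01] form a sigma-algebra containing the cells, hence they include all
    of [nadic n m]; conversely each of them is the union of the cells it contains. *)
Lemma nadicP m (B : set R) :
  nadic n m B <-> B `<=` @I01 R /\ saturated m B.
Proof.
split.
- apply: (@smallest_sub _ (sigma_algebra (@I01 R)) (nadic_itv n m)
    [set B : set R | B `<=` @I01 R /\ saturated m B]).
    split => /=; first by split=> [x []|x y _ _ _ []].
    + move=> A [AI uA]; split=> [x []//|x y Ix Iy xy [_ Ax]]; split=> //.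
      by apply: contra_not Ax; apply: uA.
    + move=> A uA; split=> [x [k _]|x y Ix Iy xy [k _ Ax]].
        by have [AI _] := uA k; exact: AI.
      by exists k => //; have [_ +] := uA k; move=> /(_ x y); exact.
  move=> _ /= [k km <-]; split; first exact: cell_I01.
  move=> x y Ix Iy xy /cellP[_ xk]; apply/cellP; split; first exact: I01_ge0.
  by rewrite -xy.
- move=> [BI uB]; rewrite (cell_inE BI uB).
  apply: sigma_algebra_bigcup => k; rewrite /cell_in.
  case: asboolP => [[km _]|_].
    exact: nadic_cell.
  exact: sigma_algebra0.
Qed.

Lemma measurable_cell_in B m k :
  measurable (cell_in B m k : set (lebesgueType R)).
Proof.
by rewrite /cell_in; case: ifP => _; [exact: measurable_cell|exact: measurable0].
Qed.

Lemma nadic_measurable m (B : set R) :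
  nadic n m B -> measurable (B : set (lebesgueType R)).
Proof.
move=> /nadicP[BI uB]; rewrite (cell_inE BI uB).
by apply: bigcupT_measurable => k; exact: measurable_cell_in.
Qed.

Lemma trivIset_cell_in B m : trivIset setT (cell_in B m).
Proof.
move=> i j _ _ [x []]; rewrite /cell_in.
case: ifP => _ // /cellP[_ <-]; case: ifP => _ // /cellP[_ <-] //.
Qed.

End NadicCells.

(** * Cell averages as the conditional expectations of an indicator *)

Section CellAverages.
Context (R : realType) (n : nat) (n_gt0 : (0 < n)%N).
Implicit Types (m k : nat) (x : R) (A : set (lebesgueType R)).

(** The factor [n%:R ^+ m] is the reciprocal length of a cell. This explicit function is the
    reference version with which [mart] is compared. *)
Definition cell_avg A m x : R :=
  n%:R ^+ m * fine (leb R (A `&` cell n m (cell_index n m x))).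

Lemma leb_setI_cell A m k : measurable A ->
  (leb R (A `&` cell n m k) <= ((n%:R ^+ m)^-1)%:E)%E.
Proof.
move=> mA; rewrite -(leb_cell R n_gt0 m k) le_measure ?inE//.
  by apply: measurableI => //; exact: measurable_cell.
exact: measurable_cell.
Qed.

Lemma leb_setI_cell_fin A m k : measurable A ->
  leb R (A `&` cell n m k) \is a fin_num.
Proof.
move=> mA; rewrite ge0_fin_numE ?measure_ge0//.
by rewrite (le_lt_trans (leb_setI_cell m k mA))// ltry.
Qed.

Lemma cell_avg_ge0 A m x : 0 <= cell_avg A m x.
Proof. by rewrite mulr_ge0 ?exprn_ge0// fine_ge0// measure_ge0. Qed.

Lemma cell_avg_le1 A m x : measurable A -> cell_avg A m x <= 1.
Proof.
move=> mA; rewrite /cell_avg -ler_pdivlMl ?expn_gt0R// mulr1 -lee_fin.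
by rewrite fineK ?leb_setI_cell_fin//; exact: leb_setI_cell.
Qed.

Lemma cell_avg_cell A m k x : cell n m k x ->
  cell_avg A m x = n%:R ^+ m * fine (leb R (A `&` cell n m k)).
Proof. by move=> /(cellP n_gt0)[_ xk]; rewrite /cell_avg xk. Qed.

Lemma nadic_preimage_cell_avg A m (Y : set R) :
  nadic n m (@I01 R `&` cell_avg A m @^-1` Y).
Proof.
apply/(nadicP n_gt0); split; first exact: subIsetl.
by move=> x y Ix Iy xy [_]; rewrite /preimage/= /cell_avg xy.
Qed.

Lemma measurable_cell_avg A m :
  measurable_fun (@I01 R : set (lebesgueType R)) (cell_avg A m).
Proof.
move=> _ Y _; apply: (nadic_measurable n_gt0 (m := m)).
exact: nadic_preimage_cell_avg.
Qed.

Lemma integral_cell_avg_cell A m k : measurable A ->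
  (\int[leb R]_(x in cell n m k) (cell_avg A m x)%:E =
   leb R (A `&` cell n m k))%E.
Proof.
move=> mA; rewrite (eq_integral
  (cst (n%:R ^+ m * fine (leb R (A `&` cell n m k)))%:E)); last first.
  by move=> x; rewrite inE => /cell_avg_cell ->.
rewrite integral_cst ?leb_cell//; last exact: measurable_cell.
rewrite -EFinM mulrAC mulfV ?gt_eqF ?expn_gt0R// mul1r fineK//.
exact: leb_setI_cell_fin.
Qed.

Lemma cell_avg_cond_exp A m : measurable A ->
  is_cond_exp (leb R) (@I01 R) (nadic n m) \1_A (cell_avg A m).
Proof.
move=> mA; split.
- by move=> Y _; exact: nadic_preimage_cell_avg.
- apply: measurable_bounded_integrable.
  + exact: measurable_I01.
  + by rewrite leb_I01 ltry.
  + exact: measurable_cell_avg.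
  + exists 1; split=> // M M1 x _ /=.
    rewrite ger0_norm ?cell_avg_ge0// (le_trans (cell_avg_le1 _ _ mA))//.
    exact: ltW.
- move=> B nB; have mB := nadic_measurable n_gt0 nB.
  have /(nadicP n_gt0)[BI uB] := nB.
  (* Both integrals split over the disjoint cells of [B], so the identity is needed on a single cell
     only. *)
  rewrite (cell_inE n_gt0 BI uB) !ge0_integral_bigcup.
  + apply: eq_eseriesr => k _; rewrite /cell_in; case: asboolP => _.
      by rewrite integral_cell_avg_cell// integral_indic//; exact: measurable_cell.
    by rewrite !integral_set0.
  + by move=> k; exact: measurable_cell_in.
  + by apply/measurable_EFinP; exact: measurable_indic.
  + by move=> x _; rewrite lee_fin indicE.
  + exact: trivIset_cell_in.
  + by move=> k; exact: measurable_cell_in.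
  + rewrite -(cell_inE n_gt0 BI uB); apply/measurable_EFinP.
    by apply: measurable_funS (measurable_cell_avg A m) => //; exact: measurable_I01.
  + by move=> x _; rewrite lee_fin cell_avg_ge0.
  + exact: trivIset_cell_in.
Qed.

(** The preimage of the singleton [g x] is saturated, so [g] is constant on the cell of [x]; the
    integral identity on that cell, of positive measure, then fixes the constant. This gives
    equality at every point of [I01], not just almost everywhere. *)
Lemma cond_exp_cell_avg A m g : measurable A ->
  is_cond_exp (leb R) (@I01 R) (nadic n m) \1_A g ->
  {in @I01 R, g =1 cell_avg A m}.
Proof.
move=> mA [gY _ gint] x; rewrite inE => Ix.
set k := cell_index n m x.
have xk : cell n m k x by apply: (cell_cell_index n_gt0); exact: I01_ge0.
have km : (k < n ^ m)%N by exact: cell_index_lt.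
have gcst y : cell n m k y -> g y = g x.
  move=> yk; have /(nadicP n_gt0)[_] := gY [set g x] (measurable_set1 _).
  have Iy : @I01 R y by exact: cell_I01 yk.
  move=> /(_ x y Ix Iy) []//=.
  by have /(cellP n_gt0)[_ ->] := yk.
have := gint _ (nadic_cell km).
rewrite (eq_integral (cst (g x)%:E)); last by move=> y /[!inE] /gcst ->.
rewrite integral_cst; last exact: measurable_cell.
rewrite integral_indic//; last exact: measurable_cell.
rewrite leb_cell// -EFinM /cell_avg => <- /=.
by rewrite mulrCA mulfV ?mulr1// gt_eqF ?expn_gt0R.
Qed.

(** [xget] makes an unspecified choice: [cell_avg] shows that a version exists, and pointwise
    uniqueness makes the choice immaterial on [I01]. *)
Lemma martE A m : measurable A -> {in @I01 R, mart n \1_A m =1 cell_avg A m}.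
Proof.
move=> mA; apply: cond_exp_cell_avg => //.
rewrite /mart /cond_exp; apply: (xgetPex (cst 0)).
by exists (cell_avg A m); exact: cell_avg_cond_exp.
Qed.

Lemma cell_avg0 A x : measurable A -> A `<=` @I01 R -> @I01 R x ->
  (cell_avg A 0 x)%:E = leb R A.
Proof.
move=> mA AI Ix; rewrite /cell_avg expr0 mul1r fineK ?leb_setI_cell_fin//.
congr (leb R _); apply/setIidPl => y /AI Iy.
(* At level [0] every index lies below [n ^ 0 = 1], so all of [I01] is one cell. *)
have /= := cell_index_lt n_gt0 0 Ix; rewrite expn0 ltnS leqn0 => /eqP ->.
apply/(cellP n_gt0); split; first exact: I01_ge0.
by apply/eqP; rewrite -leqn0 -ltnS -(expn0 n) cell_index_lt.
Qed.

Lemma measurable_S1 A : measurable A ->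
  measurable_fun (@I01 R : set (lebesgueType R)) (S1 n \1_A).
Proof.
move=> mA; rewrite /S1.
under eq_fun do rewrite eseries_cond.
apply: ge0_emeasurable_sum => // m m1.
apply/measurable_EFinP/measurableT_comp => //.
by apply: measurable_funB;
  apply: eq_measurable_fun (measurable_cell_avg A _) => x xI;
  rewrite martE.
Qed.

End CellAverages.

(** * The lower bound, by Lebesgue differentiation along cells *)

Section LowerBound.
Context (R : realType) (n : nat) (n_ge2 : (2 <= n)%N).
Let n_gt0 : (0 < n)%N := ltnW n_ge2.
Implicit Types (m k : nat) (x : R) (A : set (lebesgueType R)).

Lemma exprn_cvg0 : (n%:R ^+ m)^-1 @[m --> \oo] --> (0 : R).
Proof.
rewrite (_ : (fun m => _) = fun m => (n%:R^-1 : R) ^+ m); last first.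
  by apply/funext => m; rewrite exprVn.
apply: cvg_expr; rewrite ger0_norm ?invr_ge0 ?ler0n//.
by rewrite invf_lt1 ?ltr0n// ltr1n.
Qed.

(* Only the first case matters; the second one makes the family nicely
   shrinking at every real number, as [nice_lebesgue_differentiation] asks. *)
Let shrinking_cell x m : set R :=
  if 0 <= x then cell n m (cell_index n m x)
  else `[x, x + (n%:R ^+ m)^-1[%classic.

Let nicely_shrinking_cell x : nicely_shrinking x (shrinking_cell x).
Proof.
(* Both branches are half-open intervals of length [n^-m] containing [x]; the rest of the proof uses
   only this form. *)
have itvE m : exists a : R,
    shrinking_cell x m = `[a, a + (n%:R ^+ m)^-1[%classic /\
    a <= x < a + (n%:R ^+ m)^-1.
  rewrite /shrinking_cell; case: ifPn => [x0|_]; last first.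
    by exists x; rewrite lexx ltrDl invr_gt0 expn_gt0R.
  exists ((cell_index n m x)%:R / n%:R ^+ m).
  have := cell_cell_index n_gt0 m x0; rewrite /cell/= in_itv/=.
  by rewrite -natr1 mulrDl mul1r; split.
split=> [m|].
  by have [a [-> _]] := itvE m; exact: measurable_itv.
have r_gt0 m : 0 < (n%:R ^+ m)^-1 :> R by rewrite invr_gt0 expn_gt0R.
(* The ball of radius [n^-m] around [x] contains the interval and has length [2 n^-m], whence the
   ratio [2]. *)
exists (2, fun m => PosNum (r_gt0 m)); split => //= [|m|m].
- exact: exprn_cvg0.
- have [a [-> /andP[ax xa]]] := itvE m.
  move=> y; rewrite /= in_itv/= => /andP[ay ya].
  by rewrite /ball/= ltr_norml; apply/andP; split; lra.
- have [a [-> _]] := itvE m.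
  rewrite lebesgue_measure_ball ?(ltW (r_gt0 m))//.
  rewrite lebesgue_measure_itv/= lte_fin ltrDl r_gt0 -EFinD addrAC subrr add0r.
  by rewrite -EFinM lee_fin mulr_natl.
Qed.

(** Differentiation is applied to Borel functions, whereas [A] is Lebesgue measurable; [A] is
    therefore replaced by a Borel set [B] from which it differs by a null set. *)
Lemma ae_cell_avg_cvg A : measurable A ->
  {ae leb R, forall x, @I01 R x ->
    cell_avg n A m x @[m --> \oo] --> (\1_A x : R)}.
Proof.
move=> mA.
have : completed_algebra_gen (@lebesgue_measure R) A.
  rewrite -g_sigma_completed_algebra_genE completed_caratheodory_measurable.
  exact: mA.
move=> [B mB [N [N' [mN' N'0 NN']]] BNA].
have [M [mM M0 HM]] :=
  lebesgue_differentiation (locally_integrable_indic openT mB).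
have mcara (X : set R) : (measurable : set (set R)) X ->
  measurable (X : set (lebesgueType R)).
  by move=> mX; apply: sub_caratheodory.
(* [M] contains every point that is not a Lebesgue point of [\1_B]; [N'] is a Borel null set
   covering the part of [A] outside [B]. *)
exists (M `|` N'); split.
- by apply: measurableU; exact: mcara.
- apply/eqP; rewrite -measure_le0.
  apply: (@le_trans _ _ (leb R M + leb R N')%E).
    by apply: measureU2; exact: mcara.
  by rewrite (_ : leb R M = 0%E)// (_ : leb R N' = 0%E)// adde0.
move=> x; apply: contra_notP => /not_orP[Mx N'x] Ix.
have lx : lebesgue_pt (\1_B : R -> R) x by apply: contra_notP Mx => /HM.
have leb_AB (X : set R) : (measurable : set (set R)) X ->
    leb R (A `&` X) = lebesgue_measure (B `&` X).
  move=> mX; apply/eqP; rewrite eq_le; apply/andP; split.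
    apply: (@le_trans _ _ (leb R ((B `&` X) `|` N'))).
      apply: le_measure; rewrite ?inE.
      + by apply: measurableI => //; exact: mcara.
      + by apply: measurableU; apply: mcara => //; exact: measurableI.
      + by rewrite -BNA => y [[By|Ny] Xy]; [left|right; exact: NN'].
    apply: (@le_trans _ _ (leb R (B `&` X) + leb R N')%E).
      by apply: measureU2; apply: mcara => //; exact: measurableI.
    by rewrite (_ : leb R N' = 0%E)// adde0.
  apply: (@le_measure _ _ _ (leb R)); rewrite ?inE.
  + by apply: mcara; exact: measurableI.
  + by apply: measurableI => //; exact: mcara.
  + by rewrite -BNA => y [By Xy]; split => //; left.
have -> : \1_A x = \1_B x :> R.
  rewrite !indicE.
  congr ((_ : bool)%:R); apply/idP/idP; rewrite !inE -BNA; last by left.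
  by move=> [//|/NN'].
have := nice_lebesgue_differentiation nicely_shrinking_cell
   (locally_integrable_indic openT mB) lx.
have -> : (fun m => (lebesgue_measure (shrinking_cell x m))^-1 *
   \int[lebesgue_measure]_(y in shrinking_cell x m) (\1_B y)%:E)%E =
   (fun m => (cell_avg n A m x)%:E).
  apply/funext => m; have [mE _] := nicely_shrinking_cell x.
  rewrite integral_indic; [|exact: mE|exact: mB].
  have scE : shrinking_cell x m = cell n m (cell_index n m x).
    by rewrite /shrinking_cell (I01_ge0 Ix).
  transitivity ((lebesgue_measure (shrinking_cell x m))^-1 *
      leb R (A `&` shrinking_cell x m))%E.
    by congr (_ * _)%E; apply/esym/leb_AB.
  have -> : lebesgue_measure (shrinking_cell x m) = ((n%:R ^+ m)^-1)%:E.
    by rewrite scE; exact: (leb_cell R n_gt0 m _).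
  rewrite inver gt_eqF ?invr_gt0 ?expn_gt0R// invrK /cell_avg EFinM -scE fineK//.
  by rewrite scE; exact: leb_setI_cell_fin.
by move/fine_cvgP => [_]; apply.
Qed.

(** The first [m] martingale differences telescope to the left-hand side, and a partial sum of
    nonnegative terms is below the series. *)
Lemma S1_ge A m x : measurable A -> @I01 R x ->
  (`|cell_avg n A m x - cell_avg n A 0 x|%:E <= S1 n \1_A x)%E.
Proof.
move=> mA Ix; rewrite /S1.
apply: le_trans (nneseries_lim_ge m.+1 _); last by move=> k _ _; rewrite lee_fin.
rewrite sumEFin lee_fin -(martE n_gt0 m mA (mem_set Ix)).
rewrite -(martE n_gt0 0 mA (mem_set Ix)).
rewrite -(telescope_sumr (fun k => mart n \1_A k x) (leq0n m)).
rewrite big_add1/= (le_trans (ler_norm_sum _ _ _))//.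
Qed.

Lemma S1_ge_star A : measurable A -> A `<=` @I01 R ->
  {ae leb R, forall x, @I01 R x -> (leb_star A <= S1 n \1_A x)%E}.
Proof.
move=> mA AI; have := ae_cell_avg_cvg mA; apply: filter_app.
  exact: (ae_filter_ringOfSetsType (leb R)).
apply: aeW => x avg_cvg Ix.
have p_fin : leb R A \is a fin_num by rewrite -(cell_avg0 n_gt0 mA AI Ix).
have : (`|(\1_A x : R) - cell_avg n A 0 x|%:E <= S1 n \1_A x)%E.
  (* The passage to the limit in [m] takes place among real numbers, so an infinite value is set
     aside first. *)
  have [->|] := eqVneq (S1 n \1_A x) +oo%E; first by rewrite leey.
  move=> S1_neqy.
  have S1_fin : S1 n \1_A x \is a fin_num.
    rewrite ge0_fin_numE ?ltey//.
    by apply: le_trans (S1_ge 0 mA Ix); rewrite lee_fin.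
  rewrite -(fineK S1_fin) lee_fin.
  have cvg_norm : `|cell_avg n A m x - cell_avg n A 0 x| @[m --> \oo] -->
      `|(\1_A x : R) - cell_avg n A 0 x|.
    by apply: cvg_norm; apply: cvgB => //; [exact: avg_cvg|exact: cvg_cst].
  rewrite -(cvg_lim _ cvg_norm)//; apply: limr_le.
    by apply/cvg_ex; eexists; exact: cvg_norm.
  by apply: nearW => m; rewrite -lee_fin fineK//; exact: S1_ge.
apply: le_trans; rewrite /leb_star -(cell_avg0 n_gt0 mA AI Ix).
rewrite -EFinB -EFin_min lee_fin.
rewrite ge_min indicE; have p0 := cell_avg_ge0 n A 0 x.
have p1 := cell_avg_le1 n_gt0 0 x mA.
(* The distance from the indicator to the measure of [A] is one minus that measure on [A] and the
   measure itself off [A]; each dominates the minimum. *)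
case: (x \in A) => /=; first by rewrite ler_norm orbT.
by rewrite sub0r normrN ger0_norm// lexx.
Qed.

Lemma leb_star_le_norm01 (alpha : R) A : 0 < alpha -> measurable A ->
  A `<=` @I01 R -> (leb_star A <= norm01 alpha (S1 n \1_A))%E.
Proof.
move=> alpha0 mA AI.
have [p p0 pE] : exists2 p : R, 0 <= p & leb_star A = p%:E.
  have I0 : @I01 R 0 by rewrite /I01/= in_itv/= lexx ltr01.
  exists (Num.min (cell_avg n A 0 0) (1 - cell_avg n A 0 0)).
    by rewrite le_min cell_avg_ge0 subr_ge0 cell_avg_le1.
  by rewrite /leb_star -(cell_avg0 n_gt0 mA AI I0) -EFinB -EFin_min.
have S1_ge0 x : (0 <= S1 n \1_A x)%E by apply: nneseries_ge0.
have : ((p `^ alpha)%:E <= \int[leb R]_(x in @I01 R) (S1 n \1_A x `^ alpha))%E.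
  (* As [I01] has mass one, the constant equals its own integral and can be compared under the
     integral sign. *)
  rewrite -[leLHS]mule1 -leb_I01 -integral_cst; last exact: measurable_I01.
  apply: ae_ge0_le_integral.
  - exact: measurable_I01.
  - by move=> x _; rewrite lee_fin powR_ge0.
  - exact: measurable_cst.
  - by move=> x _; exact: poweR_ge0.
  - apply: (measurableT_comp (measurable_poweR _)).
    exact: measurable_S1.
  - have := S1_ge_star mA AI; apply: filter_app.
      exact: (ae_filter_ringOfSetsType (leb R)).
    apply: aeW => x /[apply]; rewrite pE /= -poweR_EFin.
    apply: gt0_ler_poweR; [exact: ltW| |]; by rewrite in_itv/= ?lee_fin leey andbT.
move=> le_int; rewrite /norm01 pE.
have -> : p%:E = ((p `^ alpha)%:E `^ alpha^-1)%E.
  by rewrite poweR_EFin -powRrM mulfV ?gt_eqF// powRr1.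
apply: gt0_ler_poweR le_int; first by rewrite invr_ge0 ltW.
- by rewrite in_itv/= leey andbT lee_fin powR_ge0.
- rewrite in_itv/= leey andbT; apply: integral_ge0 => x _.
  exact: poweR_ge0.
Qed.

End LowerBound.

(** Induction reduces this to two terms. With total [s], each share [c / s] lies in [[0, 1]] and is
    thus at most its power of order [alpha]; the shares add up to one. *)
Lemma powR_sum_le (R : realType) (alpha : R) (I : Type) (s : seq I) (a : I -> R) :
  0 < alpha <= 1 -> (forall i, 0 <= a i) ->
  (\sum_(i <- s) a i) `^ alpha <= \sum_(i <- s) a i `^ alpha.
Proof.
move=> /andP[alpha0 alpha1] a0; elim: s => [|i s IH].
  by rewrite !big_nil powR0// gt_eqF.
rewrite !big_cons; apply: le_trans (lerD (lexx _) IH).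
have : 0 <= \sum_(k <- s) a k by apply: sumr_ge0.
set b := \sum_(_ <- _) _ => b0.
have [s0|s_neq0] := eqVneq (a i + b) 0.
  by rewrite s0 powR0 ?addr_ge0 ?powR_ge0// gt_eqF.
have s_gt0 : 0 < a i + b by rewrite lt_neqAle eq_sym s_neq0 addr_ge0.
have part c : 0 <= c <= a i + b ->
    (a i + b) `^ alpha * (c / (a i + b)) <= c `^ alpha.
  move=> /andP[c0 cs]; have [->|c_neq0] := eqVneq c 0.
    by rewrite mul0r mulr0 powR_ge0.
  have c_gt0 : 0 < c by rewrite lt_neqAle eq_sym c_neq0.
  rewrite -[in leRHS](divfK s_neq0 c) mulrC powRM ?divr_ge0 ?(ltW s_gt0)//.
  rewrite ler_wpM2r ?powR_ge0// ger1_powR// divr_gt0//=.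
  by rewrite ler_pdivrMr// mul1r.
apply: le_trans (lerD (part (a i) _) (part b _)).
- by rewrite -mulrDr -mulrDl mulfV// mulr1.
- by rewrite a0 lerDl b0.
- by rewrite b0 lerDr a0.
Qed.

(** * The upper bound, for the first cell of each level *)

Section UpperBound.
Context (R : realType) (n : nat) (n_ge2 : (2 <= n)%N).
Let n_gt0 : (0 < n)%N := ltnW n_ge2.
Implicit Types (m k j : nat) (x : R) (A : set (lebesgueType R)).

(** A set of level [m] contains or misses each level-[m] cell entirely, so its averages there are
    one or zero. Hence the martingale is stationary from that level on. *)
Lemma cell_avg_nadic A m x : nadic n m A -> @I01 R x ->
  cell_avg n A m x = \1_A x.
Proof.
move=> /(nadicP n_gt0)[AI uA] Ix.
have subI y : cell n m (cell_index n m x) y ->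
    @I01 R y /\ cell_index n m x = cell_index n m y.
  move=> xy; split; first by apply: (cell_I01 n_gt0 _ xy); exact: cell_index_lt.
  by have /(cellP n_gt0)[_ ->] := xy.
rewrite /cell_avg indicE; case: (boolP (x \in A)) => [/[!inE] Ax|/negP/[!inE] Ax].
  rewrite (_ : _ `&` _ = cell n m (cell_index n m x)).
    by rewrite leb_cell//= mulfV// gt_eqF ?expn_gt0R.
  by apply/setIidPr => y /subI[Iy xy]; exact: uA Ax.
rewrite (_ : _ `&` _ = set0) ?measure0 ?mulr0//.
apply/seteqP; split => // y [Ay /subI[Iy xy]].
by apply: Ax; apply: uA Ay.
Qed.

Lemma nadic_cell0 j m : (j <= m)%N -> nadic n m (cell n j 0 : set R).
Proof.
move=> jm; apply/(nadicP n_gt0); split.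
  by apply: cell_I01 => //; rewrite expn_gt0 n_gt0.
(* Multiplying [x < n^-j] by [n^m] turns it into a bound on the level-[m] index, which makes the set
   saturated. *)
have cell0E x : @I01 R x -> cell n j 0 x <-> (cell_index n m x < n ^ (m - j))%N.
  move=> Ix; have x0 := I01_ge0 Ix.
  rewrite /cell/= in_itv/= mul0r x0/= /cell_index truncn_lt_nat ?mulr_ge0//.
  rewrite natrX -{1}(subnK jm) exprD mulrA mul1r.
  rewrite -ltr_pdivlMr ?expn_gt0R//.
  rewrite -[_ < (n%:R ^+ j)^-1](ltr_pM2r (expn_gt0R R n_gt0 (m - j))).
  by rewrite [n%:R ^- j * _]mulrC.
by move=> x y Ix Iy xy /(cell0E x Ix) + ; rewrite xy => /(cell0E y Iy).
Qed.

(** The first cells are nested: the one of level [j] lies wholly in the first cell of level [m] and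
    misses the others. *)
Lemma cell_avg_cell0 j m x : (m <= j)%N -> @I01 R x ->
  cell_avg n (cell n j 0) m x = n%:R ^+ m / n%:R ^+ j * \1_(cell n m 0) x.
Proof.
move=> mj Ix; rewrite /cell_avg -mulrA; congr (_ * _); rewrite indicE.
have jm0 : (cell n j 0 : set R) `<=` cell n m 0.
  move=> y; rewrite /cell/= !in_itv/= !mul0r !mul1r => /andP[-> /lt_le_trans]; apply.
  by rewrite lef_pV2 ?posrE ?expn_gt0R// ler_eXn2l// ltr1n.
case: (boolP (x \in _)) => [/[!inE]/(cellP n_gt0)[x0 ->]|].
  rewrite (_ : _ `&` _ = cell n j 0) ?leb_cell//= ?mulr1//.
  exact/setIidPl.
move=> /negP/[!inE] x_notin.
rewrite (_ : _ `&` _ = set0) ?measure0 ?mulr0//.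
apply/seteqP; split => // y [/jm0/(cellP n_gt0)[y0 y1] /(cellP n_gt0)[_ yx]].
by apply: x_notin; apply/(cellP n_gt0); split; [exact: I01_ge0|rewrite -yx].
Qed.

Lemma S1_cell0_le j x : @I01 R x ->
  (S1 n \1_(cell n j 0 : set (lebesgueType R)) x <=
   (\sum_(m < j.+1) 2 * (n%:R ^+ m / n%:R ^+ j * \1_(cell n m 0) x))%:E)%E.
Proof.
move=> Ix; have mA := measurable_cell n j 0 (R := R).
have xI := mem_set Ix.
set u := fun m => cell_avg n (cell n j 0 : set (lebesgueType R)) m x.
have dE m : mart_diff n \1_(cell n j 0 : set (lebesgueType R)) m x = u m - u m.-1.
  by rewrite /mart_diff !(martE n_gt0 _ mA xI).
have u0 m : 0 <= u m by exact: cell_avg_ge0.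
(* Beyond index [j], both [m] and [m.-1] are at least [j], so the differences vanish. *)
rewrite /S1 (@nneseries_split _ _ 1 j); last by move=> k _; rewrite lee_fin.
rewrite [X in (_ + X)%E]eseries0; last first.
  move=> m; rewrite addnC addn1 => jm _; rewrite dE.
  rewrite /u !cell_avg_nadic ?subrr ?normr0//; apply: nadic_cell0.
    by rewrite -ltnS prednK//; exact: leq_trans jm.
  exact: ltnW.
rewrite adde0 sumEFin lee_fin addnC addn1.
have -> : \sum_(m < j.+1) 2 * (n%:R ^+ m / n%:R ^+ j * \1_(cell n m 0) x) =
    \sum_(m < j.+1) 2 * u m.
  by apply: eq_bigr => m _; rewrite /u cell_avg_cell0// -ltnS.
apply: (@le_trans _ _ (\sum_(1 <= m < j.+1) (u m + u m.-1))).
  apply: ler_sum => m _; rewrite dE (le_trans (ler_normB _ _))//.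
  by rewrite !ger0_norm.
(* The two shifted sums omit [u 0] and [u j] respectively; restoring these nonnegative terms gives
   the factor [2]. *)
rewrite big_split/= big_add1/= big_add1/= -mulr_sumr mulr_natl mulr2n.
rewrite lerD// -(big_mkord xpredT u).
  by rewrite big_nat_recl// lerDr.
by rewrite big_nat_recr//= lerDl.
Qed.

Lemma norm01_cell0_le (alpha : R) : 0 < alpha < 1 ->
  exists C : R, forall j,
    (norm01 alpha (S1 n \1_(cell n j 0 : set (lebesgueType R))) <=
     C%:E * leb R (cell n j 0))%E.
Proof.
move=> /andP[alpha0 alpha1].
have n0 : 0 < n%:R :> R by rewrite ltr0n.
(* The power [n^(m alpha)] from the height and the length [n^-m] of the cell combine into
   [q ^+ m]. *)
pose q : R := n%:R `^ alpha / n%:R.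
have q0 : 0 < q by rewrite divr_gt0 ?powR_gt0.
have q1 : q < 1.
  rewrite ltr_pdivrMr// mul1r.
  rewrite -(mulr_powRB1 (ltW n0) alpha0) -[ltRHS]mulr1 ltr_pM2l//.
  rewrite -[alpha - 1]opprB powRN invf_lt1 ?powR_gt0//.
  (* The number [1] is written as a power of [1] with exponent [1 - alpha], so that strict
     monotonicity in the base applies. *)
  rewrite -[ltLHS](congr1 (fun f => f (1 - alpha)) (powR1 R)).
  by rewrite gt0_ltr_powR ?subr_gt0 ?nnegrE// ltr1n.
(* The integral will be at most [(2 n^-j)^alpha / (1 - q)]; taking the root of order [alpha] and
   factoring out the measure [n^-j] leaves this constant, independent of [j]. *)
exists (2 * (1 - q)^-1 `^ alpha^-1) => j.
pose u m x : R := 2 * (n%:R ^+ m / n%:R ^+ j * \1_(cell n m 0) x).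
have u0 m x : 0 <= u m x by rewrite !mulr_ge0// invr_ge0.
have mu m : measurable_fun (@I01 R : set (lebesgueType R))
    (fun x => (u m x `^ alpha)%:E).
  apply/measurable_EFinP.
  apply: (measurableT_comp (measurable_powR _)).
  apply: measurable_funM => //; apply: measurable_funM => //.
  apply: measurable_indic; exact: measurable_cell.
have int_u m : (\int[leb R]_(x in @I01 R) (u m x `^ alpha)%:E =
    ((2 / n%:R ^+ j) `^ alpha * q ^+ m)%:E)%E.
  rewrite (eq_integral (fun x : lebesgueType R =>
      (((2 / n%:R ^+ j) `^ alpha * (n%:R `^ alpha) ^+ m)%:E *
       (\1_(cell n m 0 : set (lebesgueType R)) x)%:E)%E)); last first.
    move=> x _; rewrite -EFinM; congr EFin.
    rewrite /u mulrA (mulrC _ (_^-1)) mulrA powRM ?mulr_ge0 ?invr_ge0//.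
    rewrite powRM ?mulr_ge0 ?invr_ge0//; congr (_ * _ * _).
      by rewrite -powR_mulrn// powRAC powR_mulrn// powR_ge0.
    (* Since [alpha] is nonzero, the power sends zero to zero and leaves the indicator unchanged. *)
    rewrite indicE; case: (_ \in _) => /=; first by rewrite powR1.
    by rewrite powR0// gt_eqF.
  rewrite ge0_integralZl_EFin; first last.
  - by rewrite mulr_ge0 ?powR_ge0// exprn_ge0// powR_ge0.
  - apply/measurable_EFinP; apply: measurable_indic; exact: measurable_cell.
  - by move=> x _; rewrite lee_fin indicE.
  - exact: measurable_I01.
  rewrite integral_indic; [|exact: measurable_I01|exact: measurable_cell].
  rewrite (_ : _ `&` _ = cell n m 0); last first.
    by apply/setIidPl/cell_I01 => //; rewrite expn_gt0 n_gt0.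
  by rewrite leb_cell// -EFinM /q expr_div_n mulrA.
rewrite leb_cell// /norm01.
have int_le : (\int[leb R]_(x in @I01 R)
    (S1 n \1_(cell n j 0 : set (lebesgueType R)) x `^ alpha) <=
    ((2 / n%:R ^+ j) `^ alpha * (1 - q)^-1)%:E)%E.
  apply: (@le_trans _ _ (\int[leb R]_(x in @I01 R)
      \sum_(m < j.+1) (u m x `^ alpha)%:E)%E).
    apply: ge0_le_integral.
    - exact: measurable_I01.
    - by move=> x _; exact: poweR_ge0.
    - apply: (measurableT_comp (measurable_poweR _)).
      by apply: measurable_S1 => //; exact: measurable_cell.
    - by apply: emeasurable_sum => m; exact: mu.
    move=> x Ix; rewrite sumEFin.
    apply: (@le_trans _ _ ((\sum_(m < j.+1) u m x)%:E `^ alpha)%E).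
      apply: gt0_ler_poweR (S1_cell0_le j Ix); first exact: ltW.
      - by rewrite in_itv/= leey andbT; exact: nneseries_ge0.
      - by rewrite in_itv/= leey andbT lee_fin sumr_ge0.
    by rewrite poweR_EFin lee_fin powR_sum_le// alpha0 ltW.
  rewrite ge0_integral_sum; [|exact: measurable_I01|exact: mu|]; last first.
    by move=> m x _; rewrite lee_fin powR_ge0.
  under eq_bigr do rewrite int_u.
  rewrite sumEFin lee_fin -(big_mkord xpredT (fun m => _ * q ^+ m)).
  (* The finite geometric sum is bounded by the full series, which removes the dependence on the
     number of terms. *)
  by apply: geometric_le_lim; rewrite ?powR_ge0// ger0_norm// ltW.
have q1' : 0 <= (1 - q)^-1 by rewrite invr_ge0 subr_ge0 ltW.
apply: (@le_trans _ _
    (((2 / n%:R ^+ j) `^ alpha * (1 - q)^-1)%:E `^ alpha^-1)%E).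
  apply: gt0_ler_poweR int_le; first by rewrite invr_ge0 ltW.
  - rewrite in_itv/= leey andbT; apply: integral_ge0 => x _; exact: poweR_ge0.
  - by rewrite in_itv/= leey andbT lee_fin mulr_ge0// powR_ge0.
rewrite poweR_EFin -EFinM lee_fin powRM ?powR_ge0//.
rewrite -powRrM mulfV ?gt_eqF// powRr1 ?divr_ge0// ?exprn_ge0//.
by rewrite mulrAC.
Qed.

End UpperBound.

Theorem theorem2p9 (R : realType) (n : nat) (n_ge2 : (2 <= n)%N) :
  (forall alpha : R, 0 < alpha < 1 ->
     forall A : set (lebesgueType R), measurable A -> A `<=` @I01 R ->
       (leb_star A <= norm01 alpha (S1 n \1_A))%E)
  /\
  (forall alpha : R, 0 < alpha < 1 ->
     exists (C : R) (A_ : nat -> set R),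
       [/\ forall j, nadic_all n (A_ j),
           forall j, (0 < leb R (A_ j))%E,
           leb R (A_ j) @[j --> \oo] --> 0%E &
           forall j, (norm01 alpha (S1 n \1_(A_ j)) <= C%:E * leb R (A_ j))%E]).
Proof.
have n_gt0 := ltnW n_ge2.
split=> [alpha /andP[alpha0 _] A|alpha alpha01].
  exact: leb_star_le_norm01.
have [C HC] := norm01_cell0_le n_ge2 alpha01.
exists C, (fun j => cell n j 0); split=> //.
- by move=> j; exists j => //; exact: nadic_cell0.
- by move=> j; rewrite leb_cell// lte_fin invr_gt0 expn_gt0R.
- rewrite (_ : (fun j => _) = fun j => ((n%:R ^+ j)^-1)%:E); last first.
    by apply/funext => j; rewrite leb_cell.
  by apply: cvg_EFin; [exact: nearW|exact: exprn_cvg0].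
Qed.
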